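(* Let $n$ be a positive integer and let $\Lambda\subset\mathbb R^n$ be a full-rank lattice of determinant one with $\operatorname{int}(S_n)\cap\Lambda=\{0\}$. Then $\Lambda=\mathbb Z^n$.
   Context: $S_n=(n+1)\Delta_n-(1,\dots,1)\subset\mathbb R^n$, where $\Delta_n=\operatorname{conv}\{0,e_1,\dots,e_n\}$ and $e_1,\dots,e_n$ is the standard basis of $\mathbb R^n$. A full-rank lattice is a set $\Lambda=M\mathbb Z^n$ with $M$ an invertible real $n\times n$ matrix; its determinant (covolume) is $\det\Lambda=|\det M|$. *)

(* Defs.v *)
From HB Require Import structures.
From mathcomp Require Import all_boot all_order all_algebra.
From mathcomp Require Import all_classical all_reals all_analysis.
Set Implicit Arguments.
Unset Strict Implicit.
Unset Printing Implicit Defensive.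
Import Order.TTheory GRing.Theory Num.Theory.
Import numFieldNormedType.Exports.
Local Open Scope classical_set_scope.
Local Open Scope ring_scope.

Definition convex_hull (R : realType) (E : lmodType R) (A : set E) : set E :=
  smallest (fun B : set E => convex_set (B : set (convex_lmodType E))) A.

(* Points of R^n are column vectors, so that M acts on Z^n by M *m z. *)
Definition std_simplex (R : realType) (n : nat) : set 'cV[R]_n :=
  convex_hull ([set 0] `|` range (fun i : 'I_n => delta_mx i 0 : 'cV[R]_n)).
Arguments std_simplex R n : clear implicits.

Definition simplexS (R : realType) (n : nat) : set 'cV[R]_n :=
  [set n.+1%:R *: x - const_mx 1 | x in std_simplex R n].
Arguments simplexS R n : clear implicits.

Definition Zlattice (R : realType) (n : nat) : set 'cV[R]_n :=
  [set x : 'cV[R]_n | forall i, x i 0 \is a Num.int].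
Arguments Zlattice R n : clear implicits.

Definition lattice_of (R : realType) (n : nat) (M : 'M[R]_n) : set 'cV[R]_n :=
  [set M *m z | z in Zlattice R n].

Definition full_rank_lattice (R : realType) (n : nat) (L : set 'cV[R]_n) : Prop :=
  exists2 M : 'M[R]_n, M \in unitmx & L = lattice_of M.

(* The value does not depend on the chosen basis matrix (lattice_detE); it is 0
   by convention when L is not a full-rank lattice. *)
Definition lattice_det (R : realType) (n : nat) (L : set 'cV[R]_n) : R :=
  xget 0 [set `|\det M| | M in
            [set M : 'M[R]_n | M \in unitmx /\ L = lattice_of M]].

Lemma lattice_of_sub_det (R : realType) (n : nat) (M N : 'M[R]_n) :
  M \in unitmx -> N \in unitmx -> lattice_of M `<=` lattice_of N ->
  `|\det N| <= `|\det M|.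
Proof.
move=> Mu Nu MN; set P := invmx N *m M.
have MNP : M = N *m P by rewrite /P mulKVmx.
have Pint i j : P i j \is a Num.int.
  have /MN [z zint zE] : lattice_of M (M *m delta_mx j 0).
    by exists (delta_mx j 0) => // k; rewrite mxE; exact: rpred_nat.
  have zP : z = P *m delta_mx j 0 by rewrite /P -mulmxA -zE mulKmx.
  by have := zint i; rewrite zP -colE mxE.
have detP : \det P \is a Num.int.
  by apply: rpred_sum => s _; rewrite rpredM ?rpred_prod// rpredX// rpredN rpred1.
have detP0 : \det P != 0.
  by rewrite -unitfE -[_ \is a _]/(P \in unitmx) unitmx_mul unitmx_inv Nu.
rewrite [in leRHS]MNP det_mulmx normrM ler_peMr//.
by rewrite norm_intr_ge1.
Qed.

Lemma lattice_detE (R : realType) (n : nat) (M : 'M[R]_n) :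
  M \in unitmx -> lattice_det (lattice_of M) = `|\det M|.
Proof.
move=> Mu; apply: xget_unique; first by exists M.
move=> _ [N [Nu MN] <-]; apply/eqP; rewrite eq_le.
by rewrite !lattice_of_sub_det// MN.
Qed.

(* Main.v *)
Require Import Defs.
From HB Require Import structures.
From mathcomp Require Import all_boot all_order all_algebra.
From mathcomp Require Import all_classical all_reals all_analysis.
From mathcomp Require Import ring lra zify.
Set Implicit Arguments.
Unset Strict Implicit.
Unset Printing Implicit Defensive.
Import Order.TTheory GRing.Theory Num.Theory.
Import numFieldNormedType.Exports.
Local Open Scope classical_set_scope.
Local Open Scope ring_scope.

(** Put y_0 = - (x_1 + ... + x_n) and y_i = x_i. This identifies R^n with the
    zero-sum hyperplane of R^(n+1), turns Z^n into the root lattice A_n, and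
    turns the interior of S_n into the set where every y_k > -1. Call
    max y - min y the spread of x. The set V of points of spread at most 1 is
    the Voronoi cell of A_n; it has volume 1.

    A nonzero point of the lattice has a coordinate y_k <= -1; so does its
    opposite, hence its spread is at least 2. Two interior points of V differ
    by a spread smaller than 2, so the translates of V by the lattice do not
    overlap. Their volume equals the determinant of the lattice, so they cover
    R^n: up to an arbitrarily small error, every p is at spread at most 1 from
    a lattice point ([approx_covering]).

    Now take p = e_a - eps e_0, up to a multiple of (1, ..., 1). Its spread is
    1 + eps, so a translate of V that covers it is centred at a nonzero lattice
    point. This point has a coordinate <= -1, and as r = p - (this point) has
    sum 1 - eps and spread at most 1, the only possibility is that the point is
    close to e_a - e_0 ([lattice_near_basis]). When eps tends to 0, the lattice
    being closed, it contains e_a - e_0, that is, the a-th vector of the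
    standard basis. So the lattice contains Z^n, and the determinants being
    equal it is Z^n ([unimodular_Zlattice]).

    The volume argument is a count in a finite quotient. The lattice M Z^n is
    replaced by A Z^n / N with A integral and A / N close to (1 + s) M, where
    the factor 1 + s makes the separation strict, so that it survives the
    rounding ([integral_matrix_approx]). The points of Z^n / N that lie in V
    represent all the N^n classes modulo Z^n ([ex_spread_le_mod]); they are
    pairwise incongruent modulo A Z^n / N, which has index |det A|, close to
    N^n ([card_incongruent]). If the translates of V missed p by a positive
    margin, the points of Z^n / N in a small cube at p would add a positive
    proportion of N^n further classes, which is too many. *)

(** * Coordinates on the zero-sum hyperplane *)

Definition hcoord (V : zmodType) (n : nat) (x : 'cV[V]_n) (k : 'I_n.+1) : V :=
  if unlift ord0 k is Some i then x i 0 else - \sum_i x i 0.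

Lemma hcoord_ord0 (V : zmodType) n (x : 'cV[V]_n) :
  hcoord x ord0 = - \sum_i x i 0.
Proof. by rewrite /hcoord unlift_none. Qed.

Lemma hcoord_lift (V : zmodType) n (x : 'cV[V]_n) i :
  hcoord x (lift ord0 i) = x i 0.
Proof. by rewrite /hcoord liftK. Qed.

Lemma sum_hcoord (V : zmodType) n (x : 'cV[V]_n) : \sum_k hcoord x k = 0.
Proof.
by rewrite big_ord_recl (eq_bigr _ (fun i _ => hcoord_lift x i)) hcoord_ord0 addNr.
Qed.

Lemma hcoord_col (V : zmodType) n (f : 'I_n.+1 -> V) : \sum_k f k = 0 ->
  forall k, hcoord (\col_i f (lift ord0 i)) k = f k.
Proof.
move=> f0 k; case: (unliftP ord0 k) => [i ->|->]; first by rewrite hcoord_lift mxE.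
rewrite hcoord_ord0; under eq_bigr do rewrite mxE.
by move/eqP: f0; rewrite big_ord_recl addr_eq0 => /eqP ->.
Qed.

Lemma hcoordD (V : zmodType) n (x y : 'cV[V]_n) k :
  hcoord (x + y) k = hcoord x k + hcoord y k.
Proof.
case: (unliftP ord0 k) => [i ->|->]; first by rewrite !hcoord_lift mxE.
rewrite !hcoord_ord0; under eq_bigr do rewrite mxE.
by rewrite big_split/= opprD.
Qed.

Lemma hcoordN (V : zmodType) n (x : 'cV[V]_n) k :
  hcoord (- x) k = - hcoord x k.
Proof.
case: (unliftP ord0 k) => [i ->|->]; first by rewrite !hcoord_lift mxE.
rewrite !hcoord_ord0; under eq_bigr do rewrite mxE.
by rewrite sumrN.
Qed.

Lemma hcoordZ (K : pzRingType) n (a : K) (x : 'cV[K]_n) k :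
  hcoord (a *: x) k = a * hcoord x k.
Proof.
case: (unliftP ord0 k) => [i ->|->]; first by rewrite !hcoord_lift mxE.
rewrite !hcoord_ord0; under eq_bigr do rewrite mxE.
by rewrite mulrN mulr_sumr.
Qed.

Lemma hcoord_map (V W : zmodType) (f : {additive V -> W}) n (x : 'cV[V]_n) k :
  hcoord (map_mx f x) k = f (hcoord x k).
Proof.
case: (unliftP ord0 k) => [i ->|->]; first by rewrite !hcoord_lift mxE.
rewrite !hcoord_ord0; under eq_bigr do rewrite mxE.
by rewrite (raddfN f) (raddf_sum f).
Qed.

Definition spread_le (K : numDomainType) n (x : 'cV[K]_n) (c : K) :=
  forall k l, hcoord x k - hcoord x l <= c.

Lemma spread_leD (K : numDomainType) n (x y : 'cV[K]_n) a b :
  spread_le x a -> spread_le y b -> spread_le (x + y) (a + b).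
Proof.
move=> xa yb k l; rewrite !hcoordD.
by rewrite opprD addrACA lerD ?xa ?yb.
Qed.

Lemma spread_leN (K : numDomainType) n (x : 'cV[K]_n) a :
  spread_le x a -> spread_le (- x) a.
Proof. by move=> xa k l; rewrite !hcoordN opprK addrC xa. Qed.

Lemma spread_leZ (K : numDomainType) n (x : 'cV[K]_n) a c : 0 <= c ->
  spread_le x a -> spread_le (c *: x) (c * a).
Proof. by move=> c0 xa k l; rewrite !hcoordZ -mulrBr ler_wpM2l. Qed.

Lemma spread_le_map_intr (K : numDomainType) n (x : 'cV[int]_n) (c : int) :
  spread_le x c -> spread_le (map_mx intr x : 'cV[K]_n) c%:~R.
Proof. by move=> xc k l; rewrite !hcoord_map -rmorphB ler_int. Qed.

Lemma spread_le_map_intrV (K : numDomainType) n (x : 'cV[int]_n) (c : int) :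
  spread_le (map_mx intr x : 'cV[K]_n) c%:~R -> spread_le x c.
Proof. by move=> xc k l; have := xc k l; rewrite !hcoord_map -rmorphB ler_int. Qed.

(** As the coordinates sum to 0, their maximum is nonnegative and their minimum
    nonpositive, so the spread bounds each of them. *)
Lemma norm_hcoord_le_spread (K : realDomainType) n (x : 'cV[K]_n) c :
  spread_le x c -> forall k, `|hcoord x k| <= c.
Proof.
have key (y : 'cV[K]_n) : spread_le y c -> forall k, hcoord y k <= c.
  move=> yc k; have [//|ck] := leP (hcoord y k) c.
  have pos l : 0 < hcoord y l.
    by have := yc k l; lra.
  have : 0 < \sum_l hcoord y l.
    by rewrite big_ord_recl ltr_wpDr// sumr_ge0// => i _; exact: ltW.
  by rewrite sum_hcoord ltxx.
move=> xc k; rewrite ler_norml key// andbT lerNl -hcoordN.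
by apply: key; exact: spread_leN.
Qed.

(** * The Voronoi cell of the integral points *)

(** A representative of x modulo N Z^n with least sum of squares works: if two
    of its coordinates differ by more than N, moving N from the larger one to
    the smaller one decreases this sum. *)
Lemma ex_spread_le_mod n (N : int) (x : 'cV[int]_n) : 0 < N ->
  exists w : 'cV[int]_n, spread_le (x + N *: w) N.
Proof.
move=> N0; pose Q (x : 'cV[int]_n) := \sum_k hcoord x k ^+ 2.
have Q0 y : 0 <= Q y by apply: sumr_ge0 => k _; exact: sqr_ge0.
have [m] := ubnP `|Q x|%N; elim: m => // m IH in x *; rewrite ltnS => Qm.
have [/forallP H|] := boolP [forall k, [forall l, hcoord x k - hcoord x l <= N]].
  by exists 0; rewrite scaler0 addr0 => k l; have /forallP := H k.
rewrite negb_forall => /existsP[k]; rewrite negb_forall => /existsP[l].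
rewrite -ltNge => Hkl.
have kl : k != l by apply: contraTneq Hkl => ->; rewrite subrr; lia.
(* Adding N e, where e has coordinate 1 at l and -1 at k, is the move from
   coordinate k to coordinate l. *)
pose d (m : 'I_n.+1) : int := (m == l)%:R - (m == k)%:R.
have sumE (f : 'I_n.+1 -> int) j : \sum_i f i * (i == j)%:R = f j.
  rewrite (bigD1 j)//= eqxx mulr1 big1 ?addr0// => i /negbTE ->.
  by rewrite mulr0.
have d0 : \sum_i d i = 0.
  rewrite sumrB; under eq_bigr do rewrite -[_%:R]mul1r.
  rewrite sumE; under eq_bigr do rewrite -[_%:R]mul1r.
  by rewrite sumE subrr.
pose e := \col_i d (lift ord0 i) : 'cV[int]_n.
have be i : hcoord e i = d i by exact: hcoord_col.
have QE : Q (x + N *: e) = Q x + N * 2%:R * (N - (hcoord x k - hcoord x l)).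
  rewrite /Q (eq_bigr (fun i => hcoord x i ^+ 2 +
    (N * 2%:R * hcoord x i + N ^+ 2) * (i == l)%:R +
    (- (N * 2%:R * hcoord x i) + N ^+ 2) * (i == k)%:R)); last first.
    move=> i _; rewrite hcoordD hcoordZ be /d.
    have [->|] := eqVneq i l.
      by rewrite [l == k]eq_sym (negbTE kl) /=; ring.
    by have [->|_] := eqVneq i k => /= _; ring.
  by rewrite !big_split/= !sumE; ring.
have [|w Hw] := IH (x + N *: e).
  have := Q0 (x + N *: e); rewrite QE.
  have: N * (N - (hcoord x k - hcoord x l)) < 0 by rewrite pmulr_rlt0//; lia.
  by have := Q0 x; lia.
by exists (e + w); rewrite scalerDr addrA.
Qed.
(** * The index of an integral sublattice *)

Lemma absz_det_unitmx n (L : 'M[int]_n) : L \in unitmx -> `|\det L|%N = 1%N.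
Proof. by rewrite unitmxE => /orP[]/eqP ->. Qed.

(** A Z^n has index |det A| in Z^n: by the Smith normal form A may be taken
    diagonal, and then the class of a vector is given by the residues of its
    entries modulo the diagonal coefficients. *)
Lemma card_incongruent n (A : 'M[int]_n) (T : finType) (f : T -> 'cV[int]_n) :
    \det A != 0 ->
    (forall s t z, f s - f t = A *m z -> s = t) ->
  (#|T| <= `|\det A|)%N.
Proof.
move=> A0 f_inj; have [L Lu [P Pu [d _ AE]]] := int_Smith_normal_form A.
pose D : 'M[int]_n := diag_mx (\row_i d`_i).
have {}AE : A = L *m D *m P.
  rewrite AE; congr (_ *m _ *m _); apply/matrixP => i j.
  by rewrite !mxE -val_eqE.
have detA : `|\det A|%N = (\prod_(i < n) `|(d`_i)%R|)%N.
  rewrite AE !det_mulmx !abszM (absz_det_unitmx Lu) (absz_det_unitmx Pu) mul1n muln1 det_diag.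
  by rewrite (big_morph _ abszM (erefl _)); apply: eq_bigr => i _; rewrite mxE.
have d0 (i : 'I_n) : d`_i != 0.
  apply: contraNneq A0 => di; rewrite -absz_eq0 detA.
  by rewrite (bigD1 i)//= di mul0n.
pose g t : {dffun forall i : 'I_n, 'I_(`|(d`_i)%R|%N.-1.+1)} :=
  [ffun i => inord (absz (modz ((invmx L *m f t) i 0) d`_i))].
have g_inj : injective g.
  move=> s t /ffunP gst.
  pose q := \col_i (divz ((invmx L *m f s) i 0) d`_i - divz ((invmx L *m f t) i 0) d`_i).
  apply: (f_inj s t (invmx P *m q)); rewrite AE -!mulmxA mulKVmx//.
  apply: (can_inj (mulKVmx Lu)) => //; rewrite [RHS]mulKmx// mulmxBr.
  rewrite mul_diag_mx; apply/colP => i; rewrite 5!mxE.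
  have := congr1 val (gst i); rewrite !ffunE /= !inordK; first last.
  - by rewrite prednK ?absz_gt0// -ltz_nat gez0_abs ?modz_ge0// ltz_mod.
  - by rewrite prednK ?absz_gt0// -ltz_nat gez0_abs ?modz_ge0// ltz_mod.
  move=> /(congr1 Posz); rewrite !gez0_abs ?modz_ge0// => E.
  have fE u : (invmx L *m f u) i 0 = \sum_j invmx L i j * f u j 0 by rewrite mxE.
  rewrite !mxE -!fE [X in X - _ = _](divz_eq _ d`_i) E.
  by rewrite [X in _ - X = _](divz_eq _ d`_i); ring.
rewrite detA; have := leq_card g g_inj.
rewrite card_dep_ffun foldrE big_map big_enum/=.
congr (_ <= _)%N; apply: eq_bigr => i _.
by rewrite card_ord prednK// absz_gt0.
Qed.
(** * Estimates in the sup norm *)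

Lemma mx_norm_entry (K : realDomainType) m n (x : 'M[K]_(m, n)) i j :
  `|x i j| <= `|x|.
Proof.
by rewrite [leRHS]/Num.norm/= mx_normrE; apply: (le_bigmax _ _ (i, j)).
Qed.

Lemma mx_norm_le (K : realDomainType) m n (x : 'M[K]_(m, n)) c :
  0 <= c -> (forall i j, `|x i j| <= c) -> `|x| <= c.
Proof.
move=> c0 xc; rewrite [leLHS]/Num.norm/= mx_normrE bigmax_le// => -[i j] _.

Qed.

Lemma norm_sum_le (K : numDomainType) n (f : 'I_n -> K) c :
  (forall i, `|f i| <= c) -> `|\sum_i f i| <= n%:R * c.
Proof.
move=> fc; rewrite (le_trans (ler_norm_sum _ _ _))//.
rewrite mulr_natl -[n in leRHS]card_ord -sumr_const.
by apply: ler_sum => i _; exact: fc.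
Qed.

Lemma mx_norm_mul (K : realDomainType) m n p
    (M : 'M[K]_(m, n)) (x : 'M[K]_(n, p)) :
  `|M *m x| <= n%:R * `|M| * `|x|.
Proof.
apply: mx_norm_le => [|i j]; first by rewrite !mulr_ge0.
rewrite mxE -mulrA; apply: norm_sum_le => k.
by rewrite normrM ler_pM// mx_norm_entry.
Qed.

Lemma norm_hcoord_le (K : realDomainType) n (x : 'cV[K]_n) k : (0 < n)%N ->
  `|hcoord x k| <= n%:R * `|x|.
Proof.
move=> n0; case: (unliftP ord0 k) => [i ->|->].
  rewrite hcoord_lift (le_trans (mx_norm_entry _ _ _))// ler_peMl//.
  by rewrite ler1n.
by rewrite hcoord_ord0 normrN; apply: norm_sum_le => i; exact: mx_norm_entry.
Qed.

Lemma spread_le_norm (K : realDomainType) n (x : 'cV[K]_n) : (0 < n)%N ->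
  spread_le x (2 * n%:R * `|x|).
Proof.
move=> n0 k l; rewrite (le_trans (ler_norm _))// (le_trans (ler_normB _ _))//.
rewrite (_ : 2 * _ * _ = n%:R * `|x| + n%:R * `|x|); last by ring.
by rewrite lerD// norm_hcoord_le.
Qed.

Lemma norm_le_spread (K : realDomainType) n (x : 'cV[K]_n) c :
  spread_le x c -> `|x| <= c.
Proof.
move=> xc; apply: mx_norm_le => [|i j].
  by rewrite (le_trans _ (xc ord0 ord0))// subrr.
by rewrite ord1 -hcoord_lift; exact: norm_hcoord_le_spread.
Qed.

Lemma det_continuous (K : numFieldType) n :
  continuous (fun M : 'M[K]_n => \det M).
Proof.
move=> M; have FM : Filter (nbhs (M : 'M[K]_n)) by exact: nbhs_filter.
have cM i j : (fun N : 'M[K]_n => N i j) @ nbhs M --> M i j.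
  exact: coord_continuous.
rewrite /continuous_at /=; move: (nbhs _) FM cM => F FM cM.
apply: cvg_big => [|s _]; first exact: add_continuous.
apply: cvgM; first exact: cvg_cst.
by apply: cvg_big => [|i _]; [exact: mul_continuous|exact: cM].
Qed.

Lemma det_near (R : realType) n (M : 'M[R]_n) c : 0 < c ->
  exists2 t : R, 0 < t &
    forall M' : 'M[R]_n, `|M' - M| < t -> `|\det M' - \det M| < c.
Proof.
move=> c0; have /cvgrPdist_lt /(_ c c0) := @det_continuous R n M.
move=> /nbhs_normP[t /= t0 Ht]; exists t => // M' MM'.
by rewrite distrC; apply: Ht => /=; rewrite distrC.
Qed.
(** * Integral approximation of the lattice *)

(** The lattice M Z^n meets the interior of the simplex only at 0. *)
Definition avoids_simplex (R : realType) n (M : 'M[R]_n) :=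
  forall z : 'cV[int]_n, z != 0 -> exists k, hcoord (M *m map_mx intr z) k <= -1.

(** Both z and - z give a coordinate that is at most -1. *)
Lemma avoids_simplex_spread (R : realType) n (M : 'M[R]_n) (z : 'cV[int]_n) c :
  avoids_simplex M -> z != 0 -> spread_le (M *m map_mx intr z) c -> 2 <= c.
Proof.
move=> MH z0 zc; have [k Hk] := MH z z0.
have [|l] := MH (- z); first by rewrite oppr_eq0.
rewrite map_mxN mulmxN hcoordN => Hl; have := zc l k; lra.
Qed.

Lemma map_intr_mul (K : pzRingType) m n p (A : 'M[int]_(m, n)) (B : 'M[int]_(n, p)) :
  map_mx intr (A *m B) = map_mx intr A *m map_mx intr B :> 'M[K]_(m, p).
Proof. exact: map_mxM. Qed.

Lemma det_intr_scale (R : realType) n (A : 'M[int]_n) (a : R) :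
  \det (a *: map_mx intr A) = a ^+ n * (\det A)%:~R.
Proof. by rewrite detZ det_map_mx. Qed.

Lemma norm_sub_floor (R : realType) (N : nat) (a : R) : 0 < N%:R :> R ->
  `|a - N%:R^-1 * (Num.floor (N%:R * a))%:~R| <= N%:R^-1.
Proof.
move=> N0; have u0 : 0 < N%:R^-1 :> R by rewrite invr_gt0.
have -> : a - N%:R^-1 * (Num.floor (N%:R * a))%:~R
    = N%:R^-1 * (N%:R * a - (Num.floor (N%:R * a))%:~R).
  by rewrite mulrBr mulKf ?gt_eqF.
have /andP[f1 f2] := floor_itv (N%:R * a).
rewrite normrM (gtr0_norm u0) ler_piMr ?(ltW u0)// ger0_norm ?subr_ge0//.
by rewrite lerBlDl; move: f2; rewrite intrD => /ltW.
Qed.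

(** A is the entrywise floor of N (1 + s) M, for s small and then N large. If
    A z / N is bounded, so is z since M is invertible, and then A z / N is
    within O(1 / N) of (1 + s) M z. When z is nonzero the latter has spread at
    least 2 (1 + s), which leaves room for the error as soon as 1 / N is small
    compared with s. *)
Lemma integral_matrix_approx (R : realType) n (M : 'M[R]_n) (B t c x : R) :
    (0 < n)%N -> M \in unitmx -> avoids_simplex M -> 0 < B -> 0 < t -> 0 < c ->
  exists (N : nat) (A : 'M[int]_n), [/\ x < N%:R,
    `|N%:R ^- n * (\det A)%:~R - \det M| < c,
    forall z : 'cV[int]_n, spread_le (A *m z) (2 * N%:Z) -> z = 0 &
    forall z : 'cV[int]_n, `|N%:R^-1 *: map_mx intr (A *m z) : 'cV[R]_n| <= B ->
      `|N%:R^-1 *: map_mx intr (A *m z) - M *m map_mx intr z| <= t].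
Proof.
move=> n0 Mu MH B0 t0 c0; have [h h0 hdet] := det_near M c0.
have nR : 0 < n%:R :> R by rewrite ltr0n.
(* Z bounds the z such that A z / N has norm at most B + 2; the term 2 covers
   the vectors of spread at most 2. *)
pose C : R := n%:R * `|invmx M|; have C0 : 0 <= C by rewrite mulr_ge0.
pose Z : R := 2 * C * (B + 2); have Z0 : 0 <= Z by apply: mulr_ge0; lra.
have ZE : Z = 2 * C * (B + 2) by [].
clearbody Z.
pose m : R := n%:R * `|M| * Z + `|M| + 1.
have nMZ0 : 0 <= n%:R * `|M| * Z by rewrite !mulr_ge0.
have m0 : 0 < m by rewrite ltr_wpDl// addr_ge0.
pose s : R := Num.min h t / (2 * m).
have s0 : 0 < s by rewrite divr_gt0 ?mulr_gt0// lt_min h0 t0.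
have sm : s * m = Num.min h t / 2.
  by rewrite /s; field; rewrite gt_eqF.
clearbody s.
have sMh : s * `|M| <= h / 2.
  rewrite (@le_trans _ _ (s * m))// ?ler_pM2l ?sm ?ler_pM2r//.
    by rewrite /m; lra.
  by rewrite ge_min lexx.
have sMt : s * (n%:R * `|M| * Z) <= t / 2.
  rewrite (@le_trans _ _ (s * m))// ?ler_pM2l ?sm ?ler_pM2r//.
    by rewrite /m; have := normr_ge0 M; lra.
  by rewrite ge_min lexx orbT.
(* Each term of y is what one of the upper bounds on u = 1 / N below needs. *)
pose y : R := `|x| + 1 + 2 / h + 2 * n%:R * Z / t + 2 * C * n%:R + n%:R * n%:R * Z / s.
have [N Ny] : exists N : nat, y < N%:R.
  by exists (Num.truncn y).+1; exact: truncnS_gt.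
have y1 : 0 <= 2 / h by rewrite divr_ge0// ltW.
have y2 : 0 <= 2 * n%:R * Z / t by rewrite divr_ge0 ?mulr_ge0// ltW.
have y3 : 0 <= 2 * C * n%:R by rewrite !mulr_ge0.
have y4 : 0 <= n%:R * n%:R * Z / s by rewrite divr_ge0 ?mulr_ge0// ltW.
have xx := ler_norm x; have x0 := normr_ge0 x.
have N0 : 0 < N%:R :> R by rewrite /y in Ny; lra.
pose u : R := N%:R^-1; have u0 : 0 < u by rewrite invr_gt0.
have uN : u * N%:R = 1 by rewrite mulVf// gt_eqF.
have uy w : 0 <= w -> w <= y -> u * w <= 1.
  by move=> w0 wy; rewrite -uN ler_pM2l// (le_trans wy)// ltW.
have u1 : u * (2 / h) < 1.
  by rewrite -[ltRHS]uN ltr_pM2l// (le_lt_trans _ Ny)// /y; lra.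
have {}u1 : u < h / 2.
  by move: u1; rewrite mulrA ltr_pdivrMr// mul1r; lra.
have u2 : n%:R * Z * u <= t / 2.
  have : u * (2 * n%:R * Z / t) <= 1 by apply: uy; rewrite // /y; lra.
  by rewrite mulrA ler_pdivrMr// mul1r; lra.
have u3 : C * n%:R * u <= 2^-1.
  by have : u * (2 * C * n%:R) <= 1 by [apply: uy; rewrite // /y; lra]; lra.
have u4 : n%:R * n%:R * Z * u < s.
  have : u * (n%:R * n%:R * Z / s) < 1.
    by rewrite -[ltRHS]uN ltr_pM2l// (le_lt_trans _ Ny)// /y; lra.
  by rewrite mulrA ltr_pdivrMr// mul1r; lra.
(* A / N = (1 + s) M - F, where F is the rounding error. *)
pose A : 'M[int]_n := map_mx (fun a => Num.floor (N%:R * ((1 + s) * a))) M.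
pose F : 'M[R]_n := (1 + s) *: M - u *: map_mx intr A.
have Fu : `|F| <= u.
  apply: mx_norm_le => [|i j]; first exact: ltW.
  by rewrite !mxE; exact: norm_sub_floor.
have AE : u *: map_mx intr A = (1 + s) *: M - F by rewrite /F opprB addrC subrK.
have AzE (z : 'cV[int]_n) : u *: map_mx intr (A *m z) =
    (1 + s) *: (M *m map_mx intr z) - F *m map_mx intr z.
  by rewrite map_intr_mul [u *: _]scalemxAl AE mulmxBl -scalemxAl.
have zZ (w : 'cV[int]_n) : `|u *: map_mx intr (A *m w) : 'cV[R]_n| <= B + 2 ->
    `|map_mx intr w : 'cV[R]_n| <= Z.
  move=> wB; set zr := map_mx intr w.
  have zrE : (1 + s) *: zr = invmx M *m (u *: map_mx intr (A *m w) + F *m zr).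
    by rewrite AzE subrK -scalemxAr mulKmx.
  have : `|(1 + s) *: zr| <= C * (B + 2 + n%:R * u * `|zr|).
    rewrite zrE (le_trans (mx_norm_mul _ _))// ler_wpM2l//.
    rewrite (le_trans (ler_normD _ _))// lerD//.
    by rewrite (le_trans (mx_norm_mul _ _))// ler_wpM2r// ler_wpM2l.
  rewrite mx_normZ gtr0_norm ?addr_gt0// => zz.
  have z0 := normr_ge0 zr.
  have := ler_wpM2r z0 u3; have := mulr_ge0 (ltW s0) z0.
  by rewrite ZE; lra.
exists N, A; split.
- by rewrite /y in Ny; lra.
- rewrite -exprVn -det_intr_scale; apply: hdet; rewrite AE.
  rewrite scalerDl scale1r addrAC [M + _]addrC addrK.
  rewrite (le_lt_trans (ler_normB _ _))// mx_normZ gtr0_norm//.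
  lra.
- move=> z Az; apply: contrapT => /eqP z0.
  have Az2 : spread_le (u *: map_mx intr (A *m z) : 'cV[R]_n) 2.
    have -> : 2 = u * (2 * N%:Z)%:~R :> R.
      by rewrite intrM mulrCA uN mulr1.
    by apply: spread_leZ; [exact: ltW|exact: spread_le_map_intr].
  have zZ' : `|map_mx intr z : 'cV[R]_n| <= Z.
    by apply: zZ; apply: le_trans (norm_le_spread Az2) _; lra.
  have Fz : `|F *m map_mx intr z| <= n%:R * u * Z.
    by rewrite (le_trans (mx_norm_mul _ _))// ler_pM ?mulr_ge0// ler_wpM2l.
  have := spread_leD Az2 (spread_le_norm (F *m map_mx intr z) n0).
  rewrite AzE subrK => sM.
  have : spread_le (M *m map_mx intr z) ((1 + s)^-1 *
     (2 + 2 * n%:R * `|F *m map_mx intr z|)).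
    rewrite -[M *m _](@scalerK _ _ (1 + s)); last by rewrite gt_eqF ?addr_gt0.
    by apply: spread_leZ => //; rewrite invr_ge0; lra.
  move=> /(avoids_simplex_spread MH z0).
  rewrite mulrC ler_pdivlMr ?addr_gt0//.
  have := ler_wpM2l (ltW nR) Fz.
  lra.
- move=> z zB; have zZ' : `|map_mx intr z : 'cV[R]_n| <= Z.
    by apply: zZ; apply: le_trans zB _; lra.
  rewrite AzE scalerDl scale1r addrAC [M *m _ + _]addrC addrK.
  rewrite (le_trans (ler_normB _ _))// mx_normZ gtr0_norm//.
  have Fz : `|F *m map_mx intr z| <= n%:R * u * Z.
    by rewrite (le_trans (mx_norm_mul _ _))// ler_pM ?mulr_ge0// ler_wpM2l.
  have : s * `|M *m map_mx intr z| <= s * (n%:R * `|M| * Z).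
    by rewrite ler_pM2l// (le_trans (mx_norm_mul _ _))// ler_wpM2l ?mulr_ge0.
  lra.
Qed.
(** * Translates of the Voronoi cell cover the space *)

(** If p were at spread more than 1 + e from all lattice points, then, with
    A / N close to M, d small compared with e, and K about d N, the following
    integral vectors would be pairwise incongruent modulo A Z^n: the N^n vectors
    of spread at most N that represent Z^n modulo N, and the K^n vectors of a
    cube of side K at N p. So N^n + K^n <= |det A|, which contradicts
    |det A| < (1 + c) N^n for c = (d / 2)^n, as K / N >= d / 2. *)
Lemma approx_covering (R : realType) n (M : 'M[R]_n) (p : 'cV[R]_n) (e : R) :
    (0 < n)%N -> M \in unitmx -> avoids_simplex M -> `|\det M| = 1 -> 0 < e ->
  exists z : 'cV[int]_n, spread_le (p - M *m map_mx intr z) (1 + e).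
Proof.
move=> n0 Mu MH detM e0; apply: contrapT => /forallNP noz.
have nR : 1 <= n%:R :> R by rewrite ler1n.
(* A vector of norm at most 2 d + t has spread at most 2 n (2 d + t) <= e;
   the bound n d <= 1 keeps the differences within a cube of side d at spread
   at most 2. *)
pose d : R := Num.min (e / 8) 1 / n%:R.
have d0 : 0 < d by rewrite divr_gt0// ?lt_min ?ltr01 ?andbT; lra.
have nd : n%:R * d = Num.min (e / 8) 1 by rewrite /d; field; lra.
have nd1 : n%:R * d <= 1 by rewrite nd ge_min lexx orbT.
have nde : n%:R * d <= e / 8 by rewrite nd ge_min lexx.
have d1 : d <= 1 by rewrite (le_trans _ nd1)// ler_peMl// ltW.
clearbody d; pose t : R := e / 4 / n%:R.
have nt : n%:R * t = e / 4 by rewrite /t; field; lra.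
have t0 : 0 < t by rewrite divr_gt0//; lra.
clearbody t; pose c : R := (d / 2) ^+ n.
have c0 : 0 < c by rewrite exprn_gt0//; lra.
have c1 : c <= 1 by rewrite exprn_ile1//; lra.
have B0 : 0 < `|p| + 3 by have := normr_ge0 p; lra.
have [N [A [Nd detA Asep Anear]]] :=
  integral_matrix_approx (1 + 2 / d) n0 Mu MH B0 t0 c0.
have dd : 0 < 2 / d by rewrite divr_gt0.
have N0 : 0 < N%:R :> R by lra.
have dN : 2 < d * N%:R by rewrite mulrC -ltr_pdivrMr//; lra.
pose K := Num.truncn (d * N%:R).
have [K1 K2] : K%:R <= d * N%:R /\ d * N%:R < K%:R + 1.
  have := @truncn_itv _ (d * N%:R); rewrite -/K -natr1 => H.
  by apply/andP; apply: H; lra.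
clearbody K; pose u : R := N%:R^-1; have u0 : 0 < u by rewrite invr_gt0.
have uN : u * N%:R = 1 by rewrite mulVf// gt_eqF.
have uK : u * K%:R <= d.
  by rewrite -[d]mul1r -[in leRHS]uN -mulrA ler_pM2l// mulrC.
have K1' : 1 <= K%:R :> R by lra.
have u1 : u <= d by rewrite (le_trans _ uK)// ler_peMr// ltW.
have Nint : 0 < N%:Z by rewrite ltz_nat -(ltr_nat R).
pose q : 'cV[int]_n := map_mx (fun a => Num.floor (N%:R * a)) p.
have pq : `|p - u *: map_mx intr q| <= u.
  apply: mx_norm_le => [|i j]; first exact: ltW.
  by rewrite !mxE; exact: norm_sub_floor.
pose col m (x : {ffun 'I_n -> 'I_m}) : 'cV[int]_n := \col_i (x i : nat)%:Z.
have colE m x i : col m x i 0 = (x i : nat)%:Z by rewrite mxE.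
have [w wP] := choice (fun x => ex_spread_le_mod (col N x) Nint).
pose v x := col N x + N%:Z *: w x.
have v_inj x x' : v x = v x' -> x = x'.
  move=> /colP vE; apply/ffunP => i; apply/val_inj => /=.
  have := vE i; rewrite mxE [RHS]mxE !colE [X in _ + X = _]mxE.
  rewrite [X in _ = _ + X]mxE => /(congr1 (fun a => modz a N)).
  rewrite ![N%:Z * _]mulrC ![_ + _ * N%:Z]addrC !modzMDl !modz_nat !modn_small//.
  by case.
(* If v x - (q + y) = A z, then p + M z is close to v x / N, whose spread is
   at most 1. *)
have sep2 x y z : v x - (q + col K y) <> A *m z.
  move=> E; apply: (noz (- z)).
  have Ey : `|map_mx intr (col K y) : 'cV[R]_n| <= K%:R.
    apply: mx_norm_le => // i j; rewrite ord1 mxE colE.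
    by rewrite normr_nat ler_nat ltnW.
  have Ev : spread_le (u *: map_mx intr (v x) : 'cV[R]_n) 1.
    have := spread_leZ (ltW u0) (@spread_le_map_intr R _ _ _ (wP x)).
    by rewrite uN.
  have ER : u *: map_mx intr (A *m z) = u *: map_mx intr (v x) -
     (u *: map_mx intr q + u *: map_mx intr (col K y)) :> 'cV[R]_n.
    by rewrite -E map_mxB [map_mx _ (q + _)]map_mxD scalerBr [u *: (_ + _)]scalerDr.
  have Ey' : `|u *: map_mx intr (col K y) : 'cV[R]_n| <= d.
    by rewrite mx_normZ gtr0_norm// (le_trans _ uK)// ler_pM2l.
  have qp : `|u *: map_mx intr q : 'cV[R]_n| <= u + `|p|.
    have -> : u *: map_mx intr q = p - (p - u *: map_mx intr q).
      by rewrite opprB addrC subrK.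
    by rewrite (le_trans (ler_normB _ _))// addrC lerD.
  have Az : `|u *: map_mx intr (A *m z) : 'cV[R]_n| <= `|p| + 3.
    rewrite ER (le_trans (ler_normB _ _))//.
    have := norm_le_spread Ev.
    have := ler_normD (u *: map_mx intr q) (u *: map_mx intr (col K y) : 'cV[R]_n).
    lra.
  have := Anear z Az; set g := (X in `|X|) => gt.
  pose r := (p - u *: map_mx intr q) - u *: map_mx intr (col K y) - g.
  have rE : p - M *m map_mx intr (- z) = u *: map_mx intr (v x) + r.
    rewrite map_mxN mulmxN opprK /r /g ER.
    by apply/colP => i; rewrite !mxE; ring.
  have r_le : `|r| <= 2 * d + t.
    rewrite (le_trans (ler_normB _ _))// lerD//.
    rewrite (le_trans (ler_normB _ _))//.
    by lra.
  rewrite rE => k l.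
  apply: le_trans (spread_leD Ev (spread_le_norm r n0) k l) _.
  have := ler_wpM2l (ltW (lt_le_trans ltr01 nR)) r_le.
  lra.
pose f (s : {ffun 'I_n -> 'I_N} + {ffun 'I_n -> 'I_K}) :=
  match s with inl x => v x | inr y => q + col K y end.
have detA0 : \det A != 0.
  apply/eqP => A0; move: detA; rewrite A0 mulr0 sub0r normrN detM; lra.
have f_inj s s' z : f s - f s' = A *m z -> s = s'.
  case: s s' => [x|y] [x'|y'] /= E.
  - have z0 : z = 0.
      apply: Asep; rewrite -E mulr_natl mulr2n.
      by apply: spread_leD (wP x) _; apply: spread_leN; exact: wP.
    congr inl; apply: v_inj; apply/eqP.
    by rewrite -subr_eq0 [v x - v x']E z0 mulmx0.
  - by have := sep2 _ _ _ E.
  - by case: (sep2 x' y (- z)); rewrite mulmxN -E opprB.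
  - congr inr; have {}E : col K y - col K y' = A *m z.
      by rewrite -E opprD addrACA subrr add0r.
    have Ey : `|map_mx intr (col K y - col K y') : 'cV[R]_n| <= K%:R.
      apply: mx_norm_le => // i j; rewrite ord1 !mxE.
      have := ltn_ord (y i); have := ltn_ord (y' i).
      rewrite intrB -(ltr_nat R) => a1; rewrite -(ltr_nat R) => a2.
      have := ler0n R (y i); have := ler0n R (y' i).
      by rewrite ler_norml /=; lra.
    have z0 : z = 0.
      apply: Asep; rewrite -E; apply: (@spread_le_map_intrV R) => k l.
      apply: le_trans (spread_le_norm (map_mx intr _) n0 k l) _.
      rewrite intrM.
      have := ler_wpM2l (ltW (lt_le_trans ltr01 nR)) Ey.
      have := ler_wpM2l (ltW (lt_le_trans ltr01 nR)) K1.
      have := ler_wpM2r (ltW N0) nd1.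
      lra.
    move: E; rewrite z0 mulmx0 => /eqP; rewrite subr_eq0 => /eqP /colP E.
    by apply/ffunP => i; apply/val_inj => /=; have := E i; rewrite !colE => -[].
have := card_incongruent detA0 f_inj.
rewrite card_sum !card_ffun !card_ord -(ler_nat R) natrD !natrX => cardA.
have Kc : c <= (u * K%:R) ^+ n.
  have : u * (d * N%:R) <= u * (2 * K%:R) by rewrite ler_pM2l//; lra.
  rewrite mulrCA uN => dK.
  by apply: lerXn2r; rewrite ?nnegrE; lra.
have : `|u ^+ n * (\det A)%:~R| < 1 + c.
  rewrite -ltrBlDl (le_lt_trans _ detA)// -[X in _ - X <= _]detM -exprVn.
  exact: lerB_dist.
rewrite normrM ger0_norm ?exprn_ge0 ?(ltW u0)// -intr_norm -natr_absz.
have := ler_wpM2l (exprn_ge0 n (ltW u0)) cardA.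
by rewrite mulrDr -!exprMn uN expr1n; lra.
Qed.

(** * The interior of the simplex *)

(** Total weight at most 1 suffices as the missing weight is put on 0. *)
Lemma convex_sum (R : realType) (E : lmodType R) (B : set E) :
    convex_set (B : set (convex_lmodType E)) -> B 0 ->
  forall m (s : 'I_m -> R) (v : 'I_m -> E), (forall i, 0 <= s i) ->
    (forall i, B (v i)) -> \sum_i s i <= 1 -> B (\sum_i s i *: v i).
Proof.
move=> Bc B0; elim=> [|m IH] s v s0 Bv; first by rewrite !big_ord0.
rewrite !big_ord_recl => s1.
have ss0 : 0 <= \sum_(i < m) s (lift ord0 i) by exact: sumr_ge0.
have [s01|s01] := leP 1 (s ord0).
  have /psumr_eq0P s0i : \sum_(i < m) s (lift ord0 i) = 0 by lra.
  rewrite (_ : s ord0 = 1); last by lra.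
  by rewrite big1 ?addr0 ?scale1r// => i _; rewrite s0i ?scale0r.
have pos : 0 < 1 - s ord0 by lra.
pose b := \sum_(i < m) (s (lift ord0 i) / (1 - s ord0)) *: v (lift ord0 i).
have Bb : B b.
  apply: IH => [i|i|]//; first by rewrite divr_ge0// ltW.
  by rewrite -mulr_suml ler_pdivrMr//; lra.
have : B (s ord0 *: v ord0 + (1 - s ord0) *: b).
  by have /set_mem := Bc _ _ (Itv01 (s0 ord0) (ltW s01)) (mem_set (Bv ord0)) (mem_set Bb).
rewrite scaler_sumr (eq_bigr (fun i => s (lift ord0 i) *: v (lift ord0 i)))//.
by move=> i _; rewrite scalerA mulrCA divff ?mulr1 ?gt_eqF.
Qed.

Lemma near_hcoord_gt (R : realType) n (x : 'cV[R]_n) k c :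
    (0 < n)%N -> c < hcoord x k ->
  \forall y \near x, c < hcoord y k.
Proof.
move=> n0 cx; have nR : 0 < n%:R :> R by rewrite ltr0n.
apply/nbhs_normP; exists ((hcoord x k - c) / n%:R).
  by rewrite /= divr_gt0// subr_gt0.
move=> y /=; rewrite ltr_pdivlMr// mulrC => xy.
have := le_lt_trans (norm_hcoord_le (x - y) k n0) xy.
by rewrite hcoordD hcoordN => /(le_lt_trans (ler_norm _)); lra.
Qed.

(** The weights (x_i + 1) / (n + 1) on the vertices e_i are nonnegative because
    x_i >= -1, and their sum is at most 1 because - (x_1 + ... + x_n) >= -1. *)
Lemma simplexS_ge (R : realType) n (x : 'cV[R]_n) :
  (forall k, -1 <= hcoord x k) -> simplexS R n x.
Proof.
move=> xk; have nR : 0 < n.+1%:R :> R by rewrite ltr0n.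
exists (n.+1%:R^-1 *: (x + const_mx 1)); last first.
  by rewrite scalerKV ?gt_eqF// addrK.
move=> B [Bc AB].
have -> : n.+1%:R^-1 *: (x + const_mx 1) =
    \sum_i ((x i 0 + 1) / n.+1%:R) *: (delta_mx i 0 : 'cV[R]_n).
  apply/colP => i; rewrite summxE (bigD1 i)//= big1 ?addr0.
    by rewrite !mxE !eqxx mulr1 mulrC.
  by move=> j ji; rewrite !mxE eq_sym (negbTE ji) mulr0.
apply: (convex_sum Bc) => [|i|i|].
- by apply: AB; left.
- by have := xk (lift ord0 i); rewrite hcoord_lift => xi; rewrite divr_ge0//; lra.
- by apply: AB; right; exists i.
- rewrite -mulr_suml ler_pdivrMr// mul1r big_split/= sumr_const card_ord.
  by have := xk ord0; rewrite hcoord_ord0 -natr1; lra.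
Qed.

Lemma simplexS_interior (R : realType) n (x : 'cV[R]_n) : (0 < n)%N ->
  (forall k, -1 < hcoord x k) -> interior (simplexS R n) x.
Proof.
move=> n0 xk.
have : \forall y \near x, forall k, -1 < hcoord y k.
  by apply: (@filter_forall _ _ _ _ (@nbhs_filter _ x)) => k; exact: near_hcoord_gt.
by apply: filterS => y yk; apply: simplexS_ge => k; exact: ltW.
Qed.

Lemma map_intr_inj (R : numDomainType) m n : injective (@map_mx int R intr m n).
Proof.
move=> x y /matrixP xy; apply/matrixP => i j; have := xy i j.
by rewrite !mxE => /intr_inj.
Qed.

Lemma Zlattice_intr (R : realType) n (z : 'cV[int]_n) :
  Zlattice R n (map_mx intr z).
Proof. by move=> i; rewrite mxE intr_int. Qed.

Lemma interior_avoids_simplex (R : realType) n (M : 'M[R]_n) :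
    (0 < n)%N -> M \in unitmx ->
  interior (simplexS R n) `&` lattice_of M = [set 0] -> avoids_simplex M.
Proof.
move=> n0 Mu H z z0; apply: contrapT => /forallNP zk.
have : (interior (simplexS R n) `&` lattice_of M) (M *m map_mx intr z).
  split; last by exists (map_mx intr z) => //; exact: Zlattice_intr.
  by apply: simplexS_interior => // k; rewrite ltNge; apply/negP.
rewrite H => /= /(congr1 (mulmx (invmx M))); rewrite mulKmx// mulmx0.
move=> Mz; move/eqP: z0; apply; apply: (@map_intr_inj R).
by rewrite Mz; apply/matrixP => i j; rewrite !mxE.
Qed.

(** * The lattice contains the standard basis *)

Lemma sum_ge_const (K : numDomainType) n (f : 'I_n -> K) c :
  (forall i, c <= f i) -> n%:R * c <= \sum_i f i.
Proof.
move=> fc; rewrite mulr_natl -[n in leLHS]card_ord -sumr_const.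
by apply: ler_sum => i _; exact: fc.
Qed.

(** The point p has coordinate 1 at i, - e at 0 and 0 elsewhere, up to a common
    shift c, and r is the family of coordinates of p - M z, shifted back; it
    has sum 1 - e. Since
    p has spread 1 + e > 1 + h, z is nonzero, so M z has a coordinate k at
    most -1, and then r k is at least 2 if k = i, at least 1 if k is another
    nonzero index, and at least 1 - e if k = 0. In the first two cases the
    spread bound makes all the other coordinates so large that the sum exceeds
    1 - e. In the third one the other coordinates are at least - 2 e and sum up
    to at most 0, so all are O(e): they are the entries of the vector delta_mx i 0 - M z. *)
Lemma lattice_near_basis (R : realType) n (M : 'M[R]_n) (i : 'I_n) (e : R) :
    (0 < n)%N -> avoids_simplex M ->
    (forall (p : 'cV[R]_n) (e' : R), 0 < e' ->
       exists z : 'cV[int]_n, spread_le (p - M *m map_mx intr z) (1 + e')) ->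
    0 < e -> e <= 1 ->
  exists z : 'cV[int]_n, `|delta_mx i 0 - M *m map_mx intr z| <= 2 * n%:R * e.
Proof.
move=> n0 MH cov e0 e1; have nR : 1 <= n%:R :> R by rewrite ler1n.
pose c : R := (1 - e) / n.+1%:R.
have nc : n.+1%:R * c = 1 - e by rewrite mulrC divfK// pnatr_eq0.
rewrite -natr1 in nc.
(* The slack h allowed on the covering satisfies n h < e, so that n
   coordinates equal to - h do not bring the sum below 1 - e. *)
pose h : R := e / n.+1%:R.
have nh : n%:R * h + h = e.
  by rewrite -[X in _ + X]mul1r -mulrDl natr1 mulrC divfK// pnatr_eq0.
have h0 : 0 < h by rewrite divr_gt0// ltr0n.
clearbody c h.
have nh0 : 0 < n%:R * h by rewrite mulr_gt0//; lra.
pose p : 'cV[R]_n := delta_mx i 0 - const_mx c.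
have bp0 : hcoord p ord0 = - e - c.
  rewrite hcoord_ord0 (eq_bigr (fun j => (j == i)%:R - c)); last first.
    by move=> j _; rewrite !mxE andbT.
  rewrite sumrB sumr_const card_ord (bigD1 i)//= eqxx big1 ?addr0; last first.
    by move=> j /negbTE ->.
  by rewrite -[c *+ n]mulr_natl /=; lra.
have bpl j : hcoord p (lift ord0 j) = (j == i)%:R - c.
  by rewrite hcoord_lift !mxE andbT.
clearbody p; have [z zP] := cov p h h0.
pose g := hcoord (M *m map_mx intr z).
pose r k := hcoord p k - g k + c.
have sr k l : r k - r l <= 1 + h.
  by have := zP k l; rewrite !hcoordD !hcoordN -/(g k) -/(g l) /r; lra.
have rsum : \sum_k r k = 1 - e.
  rewrite big_split/= sumrB !sum_hcoord subrr add0r sumr_const card_ord.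
  by rewrite -mulr_natl -natr1.
have low k l : r k - (1 + h) <= r l by have := sr k l; lra.
have sumlow k : r k + n%:R * (r k - (1 + h)) <= 1 - e.
  by rewrite -rsum (bigD1_ord k)//= lerD2l sum_ge_const.
have z0 : z != 0.
  apply/eqP => z0; have := zP (lift ord0 i) ord0.
  rewrite z0 (_ : map_mx intr 0 = 0 :> 'cV[R]_n); last first.
    by apply/matrixP => a b; rewrite !mxE.
  by rewrite mulmx0 subr0 bp0 bpl eqxx /=; lra.
have [k gk] := MH z z0; rewrite -/(g k) in gk.
have r0 : 1 - e <= r ord0.
  have := gk; case: (unliftP ord0 k) => [j ->|->] gj; last by rewrite /r bp0; lra.
  have rj1 : 1 <= r (lift ord0 j).
    by rewrite /r bpl; case: (j == i); rewrite /=; lra.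
  have := sumlow (lift ord0 j).
  have := ler_wpM2l (le_trans ler01 nR) rj1.
  by lra.
have rl l : - (2 * e) <= r l by have := low ord0 l; lra.
exists z; apply: mx_norm_le => [|j b]; first by rewrite !mulr_ge0//; lra.
rewrite ord1 !mxE andbT (_ : _ - _ = r (lift ord0 j)); last first.
  by rewrite /r bpl /g hcoord_lift mxE; ring.
have ej : r (lift ord0 j) + 2 * e <= 2 * n%:R * e.
  have : r (lift ord0 j) + 2 * e <= \sum_(l < n) (r (lift ord0 l) + 2 * e).
    rewrite (bigD1 j)//= lerDl sumr_ge0// => l _.
    by have := rl (lift ord0 l); lra.
  have := rsum; rewrite big_ord_recl => rs.
  rewrite [leRHS]big_split/= sumr_const card_ord -[(2 * e) *+ n]mulr_natl.
  lra.
rewrite ler_norml; have := rl (lift ord0 j).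
have := ler_wpM2r (ltW e0) nR.
lra.
Qed.

Lemma int_of_int_approx (R : realType) (x : R) :
  (forall e, 0 < e -> exists m : int, `|x - m%:~R| <= e) -> x \is a Num.int.
Proof.
move=> H; apply: contrapT => /negP; rewrite intrEfloor => xf.
have /andP[f1 f2] := floor_itv x.
set f := Num.floor x in xf f1 f2; rewrite intrD in f2.
have fx : f%:~R < x by rewrite lt_neqAle xf.
pose e := Num.min (x - f%:~R) (f%:~R + 1 - x) / 2.
have e0 : 0 < e by rewrite divr_gt0// lt_min !subr_gt0 fx.
have e1 : e * 2 <= x - f%:~R by rewrite divfK// ge_min lexx.
have e2 : e * 2 <= f%:~R + 1 - x by rewrite divfK// ge_min lexx orbT.
have [m] := H e e0; rewrite ler_norml => /andP[m1 m2].
have [mf|fm] := leP m f.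
  by have : m%:~R <= f%:~R :> R by [rewrite ler_int]; lra.
have : (f + 1)%:~R <= m%:~R :> R by rewrite ler_int; lia.
by rewrite intrD; lra.
Qed.

(** If delta_mx j 0 is a limit of vectors M z, then column j of the inverse of
    M is a limit of integral vectors. *)
Lemma invmx_int (R : realType) n (M : 'M[R]_n) : (0 < n)%N -> M \in unitmx ->
    (forall (i : 'I_n) (e : R), 0 < e -> e <= 1 ->
      exists z : 'cV[int]_n,
        `|delta_mx i 0 - M *m map_mx intr z| <= 2 * n%:R * e) ->
  forall i j, invmx M i j \is a Num.int.
Proof.
move=> n0 Mu appr i j; apply: int_of_int_approx => e e0.
pose c : R := n%:R * `|invmx M| * (2 * n%:R).
have c0 : 0 <= c by rewrite !mulr_ge0.
have [||z zP] := appr j (Num.min 1 (e / (c + 1))).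
- by rewrite lt_min ltr01 divr_gt0//; lra.
- by rewrite ge_min lexx.
exists (z i 0).
have -> : invmx M i j - (z i 0)%:~R =
    (invmx M *m (delta_mx j 0 - M *m map_mx intr z)) i 0.
  by rewrite mulmxBr mulKmx// -colE !mxE.
apply: le_trans (mx_norm_entry _ _ _) _.
apply: le_trans (mx_norm_mul _ _) _.
apply: le_trans (ler_wpM2l _ zP) _; first by rewrite mulr_ge0.
rewrite mulrA -/c (@le_trans _ _ (c * (e / (c + 1))))//.
  by rewrite ler_wpM2l// ge_min lexx orbT.
by rewrite mulrA ler_pdivrMr; lra.
Qed.

(** * Unimodular matrices *)

Lemma mulmx_Zlattice (R : realType) n (A : 'M[R]_n) (x : 'cV[R]_n) :
  (forall i j, A i j \is a Num.int) -> Zlattice R n x -> Zlattice R n (A *m x).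
Proof.
by move=> Aint xint i; rewrite mxE rpred_sum// => j _; rewrite rpredM.
Qed.

Lemma det_int (R : realType) n (A : 'M[R]_n) :
  (forall i j, A i j \is a Num.int) -> \det A \is a Num.int.
Proof.
by move=> Aint; rewrite rpred_sum// => s _; rewrite rpredM ?rpredX ?rpredN ?rpred1// rpred_prod.
Qed.

(** As det M = 1 or -1, Cramer's rule expresses M by the cofactors of its
    inverse, so M is integral too. *)
Lemma unimodular_Zlattice (R : realType) n (M : 'M[R]_n) :
    M \in unitmx -> `|\det M| = 1 -> (forall i j, invmx M i j \is a Num.int) ->
  lattice_of M = Zlattice R n.
Proof.
move=> Mu detM Vint.
have detM_int : \det M \is a Num.int.
  by have [->|->] : \det M = 1 \/ \det M = -1; [
    move/eqP: detM; rewrite eqr_norml => /andP[/orP[]/eqP]; tauto | |];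
    rewrite ?rpredN rpred1.
have Mint i j : M i j \is a Num.int.
  rewrite -[M]invmxK {1}/invmx unitmx_inv Mu mxE rpredM//.
    by rewrite det_inv invrK.
  rewrite mxE /cofactor rpredM ?rpredX ?rpredN ?rpred1//.
  by apply: det_int => k l; rewrite !mxE.
apply/seteqP; split => [_ [z zint <-]|x xint]; first exact: mulmx_Zlattice.
by exists (invmx M *m x); [exact: mulmx_Zlattice|rewrite mulKVmx].
Qed.

Theorem theorem7p2 (R : realType) (n : nat) (L : set 'cV[R]_n)
    (n_gt0 : (0 < n)%N)
    (latL : full_rank_lattice L)
    (detL : lattice_det L = 1)
    (intL : interior (simplexS R n) `&` L = [set 0]) :
  L = Zlattice R n.
Proof.
have [M Mu LM] := latL; rewrite LM in detL intL *.
rewrite lattice_detE// in detL.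
have MH := interior_avoids_simplex n_gt0 Mu intL.
apply: unimodular_Zlattice => //; apply: invmx_int => // i e e0 e1.
apply: lattice_near_basis => // p h h0.
exact: (approx_covering p n_gt0 Mu MH detL h0).
Qed.
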